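(* Let $n$ be a positive integer and let $\mu_1,\dots,\mu_n$ be probability measures on $\mathbb{R}$. If $(\mu_1,\dots,\mu_n)$ is jointly mixable and each $\mu_i$ is discrete, then $(\mu_1,\dots,\mu_n)$ has finitely many centers.
   Context: All probability measures are Borel. An $n$-tuple $(\mu_1,\dots,\mu_n)$ of probability measures on $\mathbb{R}$ is jointly mixable if there exist $C\in\mathbb{R}$ and real random variables $X_1,\dots,X_n$ on a common probability space such that $X_i$ has distribution $\mu_i$ for each $i$ and $X_1+\dots+X_n=C$ almost surely. Any such $C$ is called a center of $(\mu_1,\dots,\mu_n)$. A probability measure on $\mathbb{R}$ is discrete if it is concentrated on a countable set. *)

(* Defs.v *)
From HB Require Import structures.
From mathcomp Require Import all_boot all_order all_algebra.
From mathcomp Require Import all_classical all_reals all_analysis.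

Set Implicit Arguments.
Unset Strict Implicit.
Unset Printing Implicit Defensive.

Import Order.TTheory GRing.Theory Num.Theory.
Import numFieldNormedType.Exports.

Local Open Scope classical_set_scope.
Local Open Scope ring_scope.

(* Laws are compared on Borel sets only: a measure is a function on all of
   [set R], and its values outside the sigma-algebra carry no meaning. *)
Definition has_law (R : realType) d (Omega : measurableType d)
    (P : probability Omega R) (X : {RV P >-> measurableTypeR R})
    (mu : probability (measurableTypeR R) R) : Prop :=
  forall A : set (measurableTypeR R), measurable A -> distribution P X A = mu A.

Definition is_center (R : realType) (n : nat)
    (mu : 'I_n -> probability (measurableTypeR R) R) (C : R) : Prop :=
  exists (d : measure_display) (Omega : measurableType d)
         (P : probability Omega R) (X : 'I_n -> {RV P >-> measurableTypeR R}),
    (forall i, has_law (X i) (mu i)) /\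
    {ae P, forall w, \sum_(i < n) (X i w : R) = C}.

Definition jointly_mixable (R : realType) (n : nat)
    (mu : 'I_n -> probability (measurableTypeR R) R) : Prop :=
  exists C : R, is_center mu C.

Definition discrete_probability (R : realType)
    (mu : probability (measurableTypeR R) R) : Prop :=
  exists A : set R, countable A /\ mu (~` A) = 0%E.

(* Main.v *)
Require Import Defs.
From mathcomp Require Import all_boot all_order all_algebra.
From mathcomp Require Import all_classical all_reals all_analysis.

(** Each discrete law gives mass less than [1 / (n + 1)] to the complement of
    some finite set [F i].  By the union bound, any coupling of the laws
    satisfies [X i \in F i] for all [i] simultaneously with positive
    probability, so a center is a sum of one element from each [F i].  The
    [F i] do not depend on the coupling. *)

Set Implicit Arguments.
Unset Strict Implicit.
Unset Printing Implicit Defensive.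

Import Order.TTheory GRing.Theory Num.Theory.
Import numFieldNormedType.Exports.

Local Open Scope classical_set_scope.
Local Open Scope ring_scope.

Lemma measure_bigsetU_le (R : realType) d (T : measurableType d)
    (mu : {measure set T -> \bar R}) (I : Type) (r : seq I) (B : I -> set T) :
    (forall i, measurable (B i)) ->
  (mu (\big[setU/set0]_(i <- r) B i) <= \sum_(i <- r) mu (B i))%E.
Proof.
move=> mB; elim: r => [|i r IHr]; first by rewrite !big_nil measure0.
rewrite !big_cons; apply: le_trans (leeD2l _ IHr).
by apply: measureU2 => //; exact: bigsetU_measurable.
Qed.

(** By subadditivity, the [B i] together with a null set containing the failures of [Q] have total
    mass below 1, so they cannot cover a space of mass 1. *)
Lemma exists_avoiding (R : realType) d (T : measurableType d)
    (P : probability T R) (I : finType) (B : I -> set T) (Q : T -> Prop) :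
    (forall i, measurable (B i)) -> (\sum_i P (B i) < 1)%E ->
    {ae P, forall w, Q w} ->
  exists w, Q w /\ forall i, ~ B i w.
Proof.
move=> mB sB [N [mN PN0 QN]].
pose U := \big[setU/set0]_i B i.
have mU : measurable U by exact: bigsetU_measurable.
have [w Hw] : exists w, ~ (U `|` N) w.
  apply/existsNP => UNT; have : (1 < 1 :> \bar R)%E; last by rewrite ltxx.
  rewrite -{1}(probability_setT P).
  have -> : [set: T] = U `|` N by apply/seteqP; split.
  have PUN : (P (U `|` N) <= P U)%E.
    by rewrite -[leRHS]adde0 -PN0; exact: measureU2.
  apply: le_lt_trans PUN _.
  exact: le_lt_trans (measure_bigsetU_le _ _ mB) sB.
exists w; split.
  by apply/not_notP => nQ; apply: Hw; right; exact: QN.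
move=> i Bi; apply: Hw; left; rewrite /U.
by rewrite (bigD1 i) //=; left.
Qed.

(** An injective coding of a countable carrier by naturals exhausts it by an increasing sequence of
    finite sets, whose masses tend to 1 by continuity from below. *)
Lemma discrete_finite_approx (R : realType)
    (mu : probability (measurableTypeR R) R) (e : R) :
    discrete_probability mu -> 0 < e ->
  exists s : seq R, (mu (~` [set` s]) < e%:E)%E.
Proof.
move=> [A [cA muA]] e0.
have /countable_injP [f injf] := cA.
have m1 (x : R) : measurable ([set x] : set (measurableTypeR R)).
  exact: measurable_set1.
pose F (k : nat) : set (measurableTypeR R) := A `&` f @^-1` `I_k.
have mA : measurable (A : set (measurableTypeR R)) by exact: countable_measurable.
have mF k : measurable (F k).
  by apply: countable_measurable => //; apply: sub_countable cA;
     apply: subset_card_le => x [].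
have FA : \bigcup_k F k = A.
  apply/seteqP; split=> [x [k _ []] //|x Ax].
  (* The bound in [I_k] is strict, so [x] first appears at index [(f x).+1]. *)
  by exists (f x).+1 => //; split=> //=.
have muA1 : mu A = 1%E.
  by rewrite -(setCK A) probability_setC ?muA ?sube0 //; exact: measurableC.
have ndF : {homo F : n m / (n <= m)%N >-> (n <= m)%O}.
  move=> p q pq; apply/subsetPset => x [Ax /= xp]; split=> //=.
  exact: leq_trans xp pq.
have cvF : mu \o F @ \oo --> mu (\bigcup_k F k).
  by apply: nondecreasing_cvg_mu => //; rewrite FA.
rewrite FA muA1 in cvF.
(* This open ray around the limit 1 yields a single [k] with [mu (F k) > 1 - e]. *)
have : nbhs (1%E : \bar R) [set y | ((1 - e)%:E < y)%E].
  apply: open_nbhs_nbhs; split; first exact: open_ereal_gt_ereal.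
  by rewrite /= lte_fin gtrBl.
move=> /cvF [k _ /(_ k (leqnn k)) /= Hk].
have finF : finite_set (F k : set R).
  have injFk : {in F k &, injective f}.
    by move=> x y; rewrite !inE => -[Ax _] [Ay _]; apply: injf; rewrite inE.
  rewrite -(eq_finite_set (inj_card_eq injFk)).
  by apply: (@sub_finite_set _ _ `I_k) => // _ [x [_ fxk] <-].
have /finite_seqP [s Fs] := finF.
exists s; rewrite -Fs probability_setC //.
have muFk : mu (F k) \is a fin_num by exact: fin_num_measure.
move: Hk; rewrite -(fineK muFk) -EFinB !lte_fin.
by rewrite ltrBlDr [ltRHS]addrC ltrBlDr.
Qed.

Theorem proposition3p2 (R : realType) (n : nat) (hn : (0 < n)%N)
    (mu : 'I_n -> probability (measurableTypeR R) R)
    (hmix : jointly_mixable mu)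
    (hdisc : forall i : 'I_n, discrete_probability (mu i)) :
  finite_set [set C : R | is_center mu C]%classic.
Proof.
(* With this tolerance, the [n] exceptional masses add up to at most [n / (n + 1)], strictly below
   1. *)
have n0 : 0 < n.+1%:R^-1 :> R by rewrite invr_gt0 ltr0n.
have /choice [s sP] i := discrete_finite_approx (hdisc i) n0.
(* Each [c] selects one entry from every [s i]. Such selections form a finite type, so [sumf] has
   finite range. *)
pose sumf (c : {dffun forall i : 'I_n, seq_sub (s i)}) : R := \sum_i ssval (c i).
apply: (@sub_finite_set _ _ (range sumf)); last first.
  by apply: finite_image; exact: finite_finset.
move=> C [d [W [P [X [lawX sumX]]]]].
have mS i : measurable (~` [set` s i] : set (measurableTypeR R)).
  apply: measurableC; apply: countable_measurable; first exact: measurable_set1.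
  exact/finite_set_countable/finite_seq.
have mXS i : measurable (X i @^-1` (~` [set` s i])) by exact: measurable_funPTI.
have sXS : (\sum_i P (X i @^-1` (~` [set` s i])) < 1)%E.
  apply: (@le_lt_trans _ _ (\sum_(i < n) n.+1%:R^-1%:E)%E).
    (* The probability of this event is determined by [mu i] alone, so the same bound holds for
       every coupling. *)
    by apply: lee_sum => i _; rewrite [leLHS](lawX i) ?ltW.
  rewrite sumEFin sumr_const card_ord -[_ *+ n]mulr_natl lte_fin.
  by rewrite ltr_pdivrMr ?ltr0n // mul1r ltr_nat.
(* At this sample point the values [X i w] form a selection from the [s i] whose sum is [C]. *)
have [w [sumw wX]] := exists_avoiding mXS sXS sumX.
have Xs i : X i w \in s i by apply/not_notP; exact: wX.
by exists [ffun i => SeqSub (Xs i)] => //; rewrite -sumw;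
   apply: eq_bigr => i _; rewrite ffunE.
Qed.
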